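(* Let $X$ be a bounded metric space, let $0<\delta\le 1$, let $\mathcal{C}$ be the Čech cover of $X$ (the filtered basis consisting of all open balls in $X$), and let $\mathcal{U}$ be a $\delta$-filtered basis of $X$. Let $N(\mathcal{C})=\{N(\mathcal{C}_t)\}_{t>0}$ and $N(\mathcal{U})=\{N(\mathcal{U}_t)\}_{t>0}$ be their filtered nerves. Then the persistent homology $\{H_*(N(\mathcal{U}_t))\}_{t>0}$ of $N(\mathcal{U})$ is multiplicatively $(1,1/\delta)$-interleaved with the persistent homology $\{H_*(N(\mathcal{C}_t))\}_{t>0}$ of $N(\mathcal{C})$.
   Context: Write $B(x,r)$ for the open ball in $X$ with center $x$ and radius $r$. A cover of $X$ is a set of subsets of $X$ such that every point of $X$ lies in a member. The nerve $N(\mathcal{U})$ of a cover $\mathcal{U}$ is the simplicial complex with vertex set $\mathcal{U}$ in which a finite subset $\{U_0,\dots,U_n\}\subseteq\mathcal{U}$ is a face iff $U_0\cap\dots\cap U_n\neq\emptyset$; an inclusion of covers $\mathcal{U}\subseteq\mathcal{V}$ induces an inclusion $N(\mathcal{U})\subseteq N(\mathcal{V})$. A filtered basis of $X$ is a basis $\mathcal{U}$ for the metric topology on $X$ with $X\in\mathcal{U}$. For $t>0$, $\mathcal{U}_t$ denotes the cover of $X$ consisting of those members of $\mathcal{U}$ that are contained in some open ball in $X$ of radius $t$. The filtered nerve of $\mathcal{U}$ is the collection $\{N(\mathcal{U}_t)\}_{t>0}$ with the inclusions $N(\mathcal{U}_s)\subseteq N(\mathcal{U}_t)$ for $s<t$.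 For $0<\delta\le1$, a filtered basis $\mathcal{U}$ is a $\delta$-filtered basis if for every $x\in X$ and every $r>0$ there is a member $A$ of $\mathcal{U}_r$ with $B(x,\delta r)\subseteq A$. Fix a field $\mathbb{F}$; $H_*(K)$ is the homology of a simplicial complex $K$ with coefficients in $\mathbb{F}$. A persistence module $V$ is a family of $\mathbb{F}$-vector spaces $V_t$, $t>0$, with linear maps $V_{s<t}\colon V_s\to V_t$ for $s<t$ satisfying $V_{s<t}\circ V_{r<s}=V_{r<t}$ for $r<s<t$ (and $V_{t<t}$ is read as the identity). The persistent homology of a filtered nerve is the persistence module obtained by applying $H_*$, with maps induced by the inclusions. For $\lambda_1,\lambda_2\ge1$, persistence modules $V$ and $W$ are multiplicatively $(\lambda_1,\lambda_2)$-interleaved if there are linear maps $f_t\colon V_t\to W_{\lambda_1 t}$ and $g_t\colon W_t\to V_{\lambda_2 t}$ for all $t>0$ such that for all $s<t$: $f_{\lambda_2t}\circ g_t=W_{t<\lambda_1\lambda_2t}$, $g_{\lambda_1t}\circ f_t=V_{t<\lambda_1\lambda_2t}$, $g_t\circ W_{s<t}=V_{\lambda_2s<\lambda_2t}\circ g_s$, and $f_t\circ V_{s<t}=W_{\lambda_1s<\lambda_1t}\circ f_s$. *)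

(* Defs.v *)
From HB Require Import structures.
From mathcomp Require Import all_boot all_order all_algebra all_fingroup.
From mathcomp Require Import finmap generic_quotient ring_quotient.
From mathcomp Require Import interval_inference.
From mathcomp Require Import boolp classical_sets functions cardinality fsbigop.
From mathcomp Require Import reals topology.

Set Implicit Arguments.
Unset Strict Implicit.
Unset Printing Implicit Defensive.

Import Order.TTheory GRing.Theory Num.Theory.

Local Open Scope classical_set_scope.
Local Open Scope ring_scope.

Section QuotientModule.
Local Open Scope quotient_scope.
Variables (F : pzRingType) (M : lmodType F) (N : zmodClosed M)
  (NZ : scaler_closed N).

Definition quotient_module of scaler_closed N : Type := {ideal_quot N}.
Local Notation quotient := (quotient_module NZ).
HB.instance Definition _ := GRing.Zmodule.on quotient.

Definition quotient_proj (x : M) : quotient := \pi_({ideal_quot N}) x.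

Lemma quotient_projP x y :
  quotient_proj x = quotient_proj y <-> x - y \in N.
Proof.
rewrite Quotient.idealrBE; split => [h|/eqP//].
by apply/eqP; exact: h.
Qed.

Lemma quotient_projD : {morph quotient_proj : x y / x + y}.
Proof. by move=> x y; rewrite /quotient_proj raddfD. Qed.

Lemma quotient_reprK (u : quotient) :
  quotient_proj (repr (u : {ideal_quot N})) = u.
Proof. exact: reprK. Qed.

Definition quotient_scale (a : F) (u : quotient) : quotient :=
  quotient_proj (a *: repr (u : {ideal_quot N})).

Lemma quotient_scaleE a x :
  quotient_scale a (quotient_proj x) = quotient_proj (a *: x).
Proof.
apply/quotient_projP; rewrite -scalerBr NZ//.
by apply/quotient_projP; rewrite quotient_reprK.
Qed.

Let scaleA a b u :
  quotient_scale a (quotient_scale b u) = quotient_scale (a * b) u.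
Proof. by rewrite -[u]quotient_reprK !quotient_scaleE scalerA. Qed.

Let scale1 : left_id 1 quotient_scale.
Proof. by move=> u; rewrite -[u]quotient_reprK !quotient_scaleE scale1r. Qed.

Let scaleDr : right_distributive quotient_scale +%R.
Proof.
move=> a u v; rewrite -[u]quotient_reprK -[v]quotient_reprK.
by rewrite -quotient_projD !quotient_scaleE scalerDr quotient_projD.
Qed.

Let scaleDl u : {morph quotient_scale^~ u : a b / a + b}.
Proof.
move=> a b; rewrite -[u]quotient_reprK !quotient_scaleE scalerDl.
by rewrite quotient_projD.
Qed.

HB.instance Definition _ := GRing.Zmodule_isLmodule.Build F quotient
  scaleA scale1 scaleDr scaleDl.

Lemma quotient_proj_is_linear : linear quotient_proj.
Proof.
move=> a x y; rewrite quotient_projD; congr (_ + _).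
exact/esym/quotient_scaleE.
Qed.
HB.instance Definition _ :=
  GRing.isLinear.Build F M quotient *:%R quotient_proj
    quotient_proj_is_linear.

End QuotientModule.

Record simplicial_complex (V : choiceType) := SimplicialComplex {
  face : set {fset V};
  face_neq0 : forall s, face s -> s != fset0;
  face_sub : forall s t : {fset V},
    face s -> (t `<=` s)%fset -> t != fset0 -> face t
}.

Definition subcomplex (V : choiceType) (K L : simplicial_complex V) : Prop :=
  face K `<=` face L.

Definition permute_tuple (T : Type) (n : nat) (p : 'S_n) (t : n.-tuple T) :
  n.-tuple T := [tuple tnth t (p i) | i < n].

(* Oriented simplicial chains.  An n-chain is a finitely supported function on
   the orderings t = (v_0, ..., v_n) of the n-simplices of K that changes by the
   signature when the vertices are permuted: c t is the coefficient of the
   oriented simplex [v_0, ..., v_n] in c, so that c is a formal combination of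
   n-simplices modulo [v_p(0), ..., v_p(n)] = (-1)^p [v_0, ..., v_n]. *)
Definition is_chain (V : choiceType) (F : fieldType) (K : simplicial_complex V)
    (n : nat) (c : n.+1.-tuple V -> F^o) : Prop :=
  [/\ forall t : n.+1.-tuple V,
        c t != 0 -> uniq t /\ face K [fset x in tval t]%fset,
      forall (p : 'S_n.+1) (t : n.+1.-tuple V),
        c (permute_tuple p t) = (-1) ^+ p * c t
    & finite_set [set t | c t != 0] ].

Section Homology.
Variables (V : choiceType) (F : fieldType) (K : simplicial_complex V).

Definition chain_pred (n : nat) : {pred n.+1.-tuple V -> F^o} :=
  fun c => `[< is_chain K c >].

Fact chain_pred_submod_closed n : submod_closed (@chain_pred n).
Proof.
split=> [|a c d /asboolP[c1 c2 c3] /asboolP[d1 d2 d3]]; apply/asboolP.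
  split=> [t|p t|]; first by rewrite eqxx.
    by rewrite mulr0.
  by rewrite (_ : mkset _ = set0)//; apply/seteqP; split=> t //=; rewrite eqxx.
have E t : (a *: c + d) t = a * c t + d t by [].
have S t : (a *: c + d) t != 0 -> c t != 0 \/ d t != 0.
  rewrite E; have [->|] := eqVneq (c t) 0; last by left.
  by rewrite mulr0 add0r; right.
split=> [t /S[/c1|/d1]//|p t|].
  by rewrite !E c2 d2 mulrDr mulrCA.
apply: (@sub_finite_set _ _ ([set t | c t != 0] `|` [set t | d t != 0])).
  by move=> t /S.
by rewrite finite_setU.
Qed.
HB.instance Definition _ n := GRing.isSubmodClosed.Build F _ (@chain_pred n)
  (chain_pred_submod_closed n).

Record chain (n : nat) := Chain {
  chain_fun :> n.+1.-tuple V -> F^o;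
  chain_funP : chain_fun \in @chain_pred n
}.
HB.instance Definition _ n := [isSub for @chain_fun n].
HB.instance Definition _ n := [Choice of chain n by <:].
HB.instance Definition _ n := [SubChoice_isSubLmodule of chain n by <:].

Lemma chainP n (c : chain n) : is_chain K c.
Proof. exact/asboolP/chain_funP. Qed.

(* In [w, v_1, ..., v_n] the face [v_1, ..., v_n] has sign +1, so the
   coefficient of tau in the boundary of c is the sum of those of [w, tau]; this
   is the usual boundary sum_i (-1)^i [v_0, ..., v_(i-1), v_(i+1), ..., v_n]. *)
Definition boundary_fun n (c : n.+2.-tuple V -> F^o) : n.+1.-tuple V -> F^o :=
  fun tau => \sum_(w \in [set: V]) c [tuple of w :: tau].

Lemma finite_chain_cons n (c : chain n.+1) (tau : n.+1.-tuple V) :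
  finite_set [set w | c [tuple of w :: tau] != 0].
Proof.
have [_ _ fc] := chainP c.
apply: (@sub_finite_set _ _ ((@thead n.+1 V) @` [set t | c t != 0])).
  by move=> w /= cw; exists [tuple of w :: tau].
exact: finite_image.
Qed.

Lemma boundary_funE n (c : chain n.+1) (tau : n.+1.-tuple V) (s : seq V) :
  uniq s -> (forall w, c [tuple of w :: tau] != 0 -> w \in s) ->
  boundary_fun c tau = \sum_(w <- s) c [tuple of w :: tau].
Proof.
move=> us cs; rewrite /boundary_fun (fsbigE s)//.
- by apply: eq_bigl => w; rewrite in_setT.
- by move=> w _; apply: contraNeq; exact: cs.
Qed.

Lemma boundary_fun_neq0 n (c : chain n.+1) (tau : n.+1.-tuple V) :
  boundary_fun c tau != 0 -> exists w, c [tuple of w :: tau] != 0.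
Proof.
apply: contra_neqP => /forallNP c0.
by rewrite /boundary_fun fsbig1// => w _; apply/eqP; have /negP/negPn := c0 w.
Qed.

Lemma permute_tuple_cons n (p : 'S_n) (w : V) (t : n.-tuple V) :
  [tuple of w :: permute_tuple p t] =
  permute_tuple (lift_perm ord0 ord0 p) [tuple of w :: t].
Proof.
apply: eq_from_tnth => i; rewrite !tnth_mktuple.
have [j ->|->] := unliftP ord0 i.
  by rewrite lift_perm_lift !tnthS tnth_mktuple.
by rewrite lift_perm_id !tnth0.
Qed.

Lemma boundary_is_chain n (c : chain n.+1) : is_chain K (boundary_fun c).
Proof.
have [c1 c2 c3] := chainP c; split.
- move=> t /boundary_fun_neq0[w /c1[/= /andP[_ ut] ft]]; split=> //.
  apply: face_sub ft _ _.
    by apply/fsubsetP => x; rewrite !inE => ->; rewrite orbT.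
  by apply/fset0Pn; exists (thead t); rewrite inE; exact: mem_tnth.
- move=> p t; pose s := fset_set [set w | c [tuple of w :: t] != 0].
  have sP w : (w \in s) = (c [tuple of w :: t] != 0).
    rewrite in_fset_set; last exact: finite_chain_cons.
    by apply/idP/idP; rewrite inE.
  have E w : c [tuple of w :: permute_tuple p t] =
             (-1) ^+ p * c [tuple of w :: t].
    by rewrite permute_tuple_cons c2 odd_lift_perm.
  rewrite !(@boundary_funE _ c _ s) ?fset_uniq//.
  + by rewrite mulr_sumr; apply: eq_bigr => w _; rewrite E.
  + by move=> w; rewrite sP.
  + by move=> w; rewrite sP E; apply: contraNN => /eqP ->; rewrite mulr0.
- apply: (@sub_finite_set _ _
    ((fun t : n.+2.-tuple V => [tuple of behead t]) @` [set t | c t != 0])).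
    move=> t /boundary_fun_neq0[w cw]; exists [tuple of w :: t] => //.
    exact: val_inj.
  exact: finite_image.
Qed.

Definition boundary n (c : chain n.+1) : chain n :=
  Chain (asboolT (boundary_is_chain c)).

Fact boundary_is_linear n : linear (@boundary n).
Proof.
move=> a c d; apply: val_inj; apply/funext => t /=.
pose s := fset_set ([set w | c [tuple of w :: t] != 0] `|`
                    [set w | d [tuple of w :: t] != 0]).
have sP w : c [tuple of w :: t] != 0 \/ d [tuple of w :: t] != 0 -> w \in s.
  by move=> cd; rewrite in_fset_set ?inE// finite_setU; split;
    exact: finite_chain_cons.
have E w : (a *: c + d) [tuple of w :: t] =
  a * c [tuple of w :: t] + d [tuple of w :: t] by [].
rewrite [RHS](_ : _ = a * boundary_fun c t + boundary_fun d t)//.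
rewrite (boundary_funE (c := a *: c + d) (fset_uniq _ : uniq s)); last first.
  move=> w; rewrite E => cd; apply: sP; apply/orP; apply: contraNT cd.
  by rewrite negb_or !negbK => /andP[/eqP-> /eqP->]; rewrite mulr0 addr0.
rewrite (boundary_funE (c := c) (fset_uniq _ : uniq s)); last first.
  by move=> w cw; apply: sP; left.
rewrite (boundary_funE (c := d) (fset_uniq _ : uniq s)); last first.
  by move=> w dw; apply: sP; right.
by rewrite mulr_sumr -big_split; apply: eq_bigr.
Qed.
HB.instance Definition _ n :=
  GRing.isLinear.Build F (chain n.+1) (chain n) *:%R (@boundary n)
    (@boundary_is_linear n).

Lemma sum_alternating (s : seq V) (a : V -> V -> F) :
  (forall u, a u u = 0) -> (forall u w, a u w + a w u = 0) ->
  \sum_(w <- s) \sum_(u <- s) a u w = 0.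
Proof.
move=> aa au; elim: s => [|x s IH]; first by rewrite big_nil.
rewrite big_cons big_cons aa add0r.
under [X in _ + X]eq_bigr do rewrite big_cons.
by rewrite big_split/= IH addr0 -big_split big1//= => w _; rewrite au.
Qed.

Lemma boundary_boundary n (c : chain n.+2) : boundary (boundary c) = 0.
Proof.
have [c1 c2 c3] := chainP c.
apply: val_inj; apply/funext => t.
pose h (i : 'I_n.+3) (t : n.+3.-tuple V) := tnth t i.
pose s := fset_set (h ord0 @` [set t | c t != 0] `|`
                    h (lift ord0 ord0) @` [set t | c t != 0]).
have sP u w : c [tuple of u :: [tuple of w :: t]] != 0 -> u \in s /\ w \in s.
  move=> cuw; have fs : finite_set (h ord0 @` [set t | c t != 0] `|`
                    h (lift ord0 ord0) @` [set t | c t != 0]).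
    by rewrite finite_setU; split; exact: finite_image.
  rewrite !in_fset_set// !inE; split; [left|right].
    by exists [tuple of u :: [tuple of w :: t]].
  by exists [tuple of u :: [tuple of w :: t]].
have -> : val (boundary (boundary c)) t =
    \sum_(w <- s) \sum_(u <- s) c [tuple of u :: [tuple of w :: t]].
  rewrite [LHS](boundary_funE (fset_uniq _ : uniq s)) => [|w].
    apply: eq_bigr => w _.
    by apply: boundary_funE (fset_uniq _) _ => u /sP[].
  by move=> /boundary_fun_neq0[u /sP[]].
apply: (@sum_alternating s (fun u w => c [tuple of u :: [tuple of w :: t]])).
  by move=> u; apply: contraTeq isT => /c1[/=]; rewrite inE eqxx.
move=> u w; rewrite [X in _ + X](_ : _ = - c [tuple of u :: [tuple of w :: t]]).
  by rewrite subrr.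
have := c2 (tperm ord0 (lift ord0 ord0)) [tuple of u :: [tuple of w :: t]].
rewrite odd_tperm expr1 mulN1r => <-.
congr (c _); apply: eq_from_tnth => i; rewrite tnth_mktuple.
case: tpermP => [->|->|/eqP + /eqP] //.
have [j ->|->//] := unliftP ord0 i.
have [k ->|->//] := unliftP ord0 j.
by rewrite !tnthS.
Qed.

(* Homology is unreduced: every 0-chain is a cycle. *)
Definition cycle_pred (n : nat) : {pred chain n} :=
  match n return {pred chain n} with
  | 0 => fun=> true
  | m.+1 => fun c => boundary c == 0
  end.

Fact cycle_pred_submod_closed n : submod_closed (@cycle_pred n).
Proof.
case: n => [|n]; first by split.
split=> [|a c d /eqP c0 /eqP d0]; apply/eqP; first exact: linear0.
by rewrite [LHS]linearP /= c0 d0 scaler0 addr0.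
Qed.
HB.instance Definition _ n := GRing.isSubmodClosed.Build F _ (@cycle_pred n)
  (cycle_pred_submod_closed n).

Record cycle (n : nat) := Cycle {
  cycle_chain :> chain n;
  cycle_chainP : cycle_chain \in @cycle_pred n
}.
HB.instance Definition _ n := [isSub for @cycle_chain n].
HB.instance Definition _ n := [Choice of cycle n by <:].
HB.instance Definition _ n := [SubChoice_isSubLmodule of cycle n by <:].

Definition bounding_pred (n : nat) : {pred cycle n} :=
  fun z => `[< exists d : chain n.+1, boundary d = z >].

Fact bounding_pred_submod_closed n : submod_closed (@bounding_pred n).
Proof.
split=> [|a c d /asboolP[x xc] /asboolP[y yd]]; apply/asboolP.
  by exists 0; rewrite linear0.
by exists (a *: x + y); rewrite linearP /= xc yd.
Qed.
HB.instance Definition _ n := GRing.isSubmodClosed.Build F _ (@bounding_pred n)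
  (bounding_pred_submod_closed n).

Fact bounding_pred_scaler_closed n : scaler_closed (@bounding_pred n).
Proof. exact: rpredZ. Qed.

Definition homology (n : nat) : lmodType F :=
  quotient_module (@bounding_pred_scaler_closed n).

Definition homology_class n (z : cycle n) : homology n :=
  quotient_proj (@bounding_pred_scaler_closed n) z.

Lemma homology_classK n (u : homology n) : exists z, u = homology_class z.
Proof.
exists (repr (u : {ideal_quot @bounding_pred n})).
by apply: esym; exact: quotient_reprK.
Qed.

End Homology.

Section InducedByInclusion.
Variables (V : choiceType) (F : fieldType) (K L : simplicial_complex V).
Hypothesis KL : subcomplex K L.

Lemma chain_incl_is_chain n (c : chain F K n) : is_chain L c.
Proof. by have [c1 c2 c3] := chainP c; split=> // t /c1[ut /KL]. Qed.

Definition chain_incl n (c : chain F K n) : chain F L n :=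
  Chain (asboolT (chain_incl_is_chain c)).

Fact chain_incl_is_linear n : linear (@chain_incl n).
Proof. by move=> a c d; apply: val_inj. Qed.
HB.instance Definition _ n :=
  GRing.isLinear.Build F (chain F K n) (chain F L n) *:%R (@chain_incl n)
    (@chain_incl_is_linear n).

Lemma boundary_chain_incl n (c : chain F K n.+1) :
  boundary (chain_incl c) = chain_incl (boundary c).
Proof. exact: val_inj. Qed.

Lemma cycle_incl_is_cycle n (z : cycle F K n) :
  chain_incl z \in @cycle_pred V F L n.
Proof.
case: n z => // n [z /= /eqP z0]; apply/eqP.
by rewrite boundary_chain_incl z0 linear0.
Qed.

Definition cycle_incl n (z : cycle F K n) : cycle F L n :=
  Cycle (cycle_incl_is_cycle z).

Fact cycle_incl_is_linear n : linear (@cycle_incl n).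
Proof. by move=> a c d; do 2 apply: val_inj. Qed.
HB.instance Definition _ n :=
  GRing.isLinear.Build F (cycle F K n) (cycle F L n) *:%R (@cycle_incl n)
    (@cycle_incl_is_linear n).

Definition homology_incl n (u : homology F K n) : homology F L n :=
  homology_class (cycle_incl (repr (u : {ideal_quot @bounding_pred V F K n}))).

Lemma homology_inclE n (z : cycle F K n) :
  homology_incl (homology_class z) = homology_class (cycle_incl z).
Proof.
apply/quotient_projP; rewrite -linearB.
have /quotient_projP/asboolP[d dz] :=
  quotient_reprK (homology_class z : quotient_module _).
apply/asboolP; exists (chain_incl d); rewrite boundary_chain_incl dz.
exact: val_inj.
Qed.

Fact homology_incl_is_linear n : linear (@homology_incl n).
Proof.
move=> a u v; rewrite -[u]quotient_reprK -[v]quotient_reprK -linearP.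
by rewrite !homology_inclE linearP [LHS]linearP.
Qed.
HB.instance Definition _ n :=
  GRing.isLinear.Build F (homology F K n) (homology F L n) *:%R
    (@homology_incl n) (@homology_incl_is_linear n).

End InducedByInclusion.

(* The maps are indexed by s <= t, pm_map_id being the convention that the map
   from V_t to V_t is the identity. *)
Record persistence_module (R : realType) (F : fieldType) := PersistenceModule {
  pm_space :> {posnum R} -> lmodType F;
  pm_map : forall s t : {posnum R}, s%:num <= t%:num ->
    {linear pm_space s -> pm_space t};
  pm_map_id : forall (t : {posnum R}) (tt : t%:num <= t%:num) v,
    pm_map tt v = v;
  pm_map_comp : forall (r s t : {posnum R}) (rs : r%:num <= s%:num)
      (st : s%:num <= t%:num) (rt : r%:num <= t%:num) v,
    pm_map st (pm_map rs v) = pm_map rt v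
}.

Definition mul_pos (R : realType) (l t : {posnum R}) : {posnum R} :=
  (l%:num * t%:num)%:pos.

(* The inequalities le hold because 1 <= l1 and 1 <= l2; quantifying over their
   (unique) proofs only names the structure map of the target. *)
Definition multiplicatively_interleaved (R : realType) (F : fieldType)
    (l1 l2 : {posnum R}) (V W : persistence_module R F) : Prop :=
  [/\ 1 <= l1%:num, 1 <= l2%:num &
   exists (f : forall t, {linear V t -> W (mul_pos l1 t)})
          (g : forall t, {linear W t -> V (mul_pos l2 t)}),
   [/\ forall t (le : t%:num <= (mul_pos l1 (mul_pos l2 t))%:num) w,
         f (mul_pos l2 t) (g t w) = pm_map W le w,
       forall t (le : t%:num <= (mul_pos l2 (mul_pos l1 t))%:num) v,
         g (mul_pos l1 t) (f t v) = pm_map V le v,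
       forall s t (st : s%:num <= t%:num)
           (le : (mul_pos l2 s)%:num <= (mul_pos l2 t)%:num) w,
         g t (pm_map W st w) = pm_map V le (g s w)
     & forall s t (st : s%:num <= t%:num)
           (le : (mul_pos l1 s)%:num <= (mul_pos l1 t)%:num) v,
         f t (pm_map V st v) = pm_map W le (f s v)]].

Record filtered_complex (R : realType) (V : choiceType) := FilteredComplex {
  fc_complex :> {posnum R} -> simplicial_complex V;
  fc_sub : forall s t : {posnum R}, s%:num <= t%:num ->
    subcomplex (fc_complex s) (fc_complex t)
}.

Section PersistentHomology.
Variables (R : realType) (F : fieldType) (V : choiceType).
Variables (K : filtered_complex R V) (n : nat).

Definition persistent_homology_map (s t : {posnum R}) (st : s%:num <= t%:num) :
    {linear homology F (K s) n -> homology F (K t) n} :=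
  @homology_incl V F _ _ (@fc_sub R V K s t st) n.

Fact persistent_homology_map_id (t : {posnum R}) (tt : t%:num <= t%:num)
    (u : homology F (K t) n) : persistent_homology_map tt u = u.
Proof.
have [z ->] := homology_classK u; rewrite /= homology_inclE.
by congr homology_class; do 2 apply: val_inj.
Qed.

Fact persistent_homology_map_comp (r s t : {posnum R})
    (rs : r%:num <= s%:num) (st : s%:num <= t%:num) (rt : r%:num <= t%:num)
    (u : homology F (K r) n) :
  persistent_homology_map st (persistent_homology_map rs u) =
  persistent_homology_map rt u.
Proof.
have [z ->] := homology_classK u; rewrite /= !homology_inclE.
by congr homology_class; do 2 apply: val_inj.
Qed.

Definition persistent_homology : persistence_module R F :=
  PersistenceModule persistent_homology_map_id persistent_homology_map_comp.

End PersistentHomology.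

Section Nerve.
Variable X : Type.

(* The empty subset of X, when it belongs to U, lies in no face. *)
Definition is_nerve_face (U : set (set X)) (s : {fset set X}) : Prop :=
  [/\ s != fset0, (forall A, A \in s -> U A) &
      exists x, forall A, A \in s -> A x].

Fact is_nerve_face_neq0 U s : is_nerve_face U s -> s != fset0.
Proof. by case. Qed.

Fact is_nerve_face_sub U (s t : {fset set X}) :
  is_nerve_face U s -> (t `<=` s)%fset -> t != fset0 -> is_nerve_face U t.
Proof.
move=> [_ sU [x sx]] /fsubsetP ts t0; split=> // [A /ts/sU//|].
by exists x => A /ts/sx.
Qed.

Definition nerve (U : set (set X)) : simplicial_complex (set X) :=
  SimplicialComplex (@is_nerve_face_neq0 U) (@is_nerve_face_sub U).

Lemma nerve_sub (U W : set (set X)) :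
  U `<=` W -> subcomplex (nerve U) (nerve W).
Proof. by move=> UW s [s0 sU sx]; split=> // A /sU/UW. Qed.

End Nerve.

Section FilteredBasis.
Variables (R : realType) (X : metricType R).

Definition bounded_space : Prop := exists M : R, forall x y : X, mdist x y <= M.

Definition filtered_basis (U : set (set X)) : Prop := basis U /\ U [set: X].

Definition cover_at (U : set (set X)) (t : R) : set (set X) :=
  [set A | U A /\ exists x : X, A `<=` ball x t].

Lemma cover_at_le (U : set (set X)) (s t : R) :
  s <= t -> cover_at U s `<=` cover_at U t.
Proof.
move=> st A [UA [x Ax]]; split=> //; exists x.
exact: subset_trans (le_ball st).
Qed.

Fact filtered_nerve_sub (U : set (set X)) (s t : {posnum R}) :
  s%:num <= t%:num ->
  subcomplex (nerve (cover_at U s%:num)) (nerve (cover_at U t%:num)).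
Proof. by move=> st; exact/nerve_sub/cover_at_le. Qed.

Definition filtered_nerve (U : set (set X)) : filtered_complex R (set X) :=
  FilteredComplex (@filtered_nerve_sub U).

Definition delta_filtered_basis (delta : R) (U : set (set X)) : Prop :=
  filtered_basis U /\
  forall (x : X) (r : R), 0 < r ->
    exists2 A, cover_at U r A & ball x (delta * r) `<=` A.

Definition cech_cover : set (set X) :=
  [set A | exists x : X, exists2 r : R, 0 < r & A = ball x r].

(* The empty space has no open ball, hence the point x0. *)
Lemma cech_filtered_basis (x0 : X) : bounded_space -> filtered_basis cech_cover.
Proof.
move=> [M XM]; split; last first.
  exists x0, (`|M| + 1); first by rewrite ltr_wpDl.
  apply/seteqP; split=> // y _; rewrite ballEmdist /=.
  by rewrite (le_lt_trans (XM _ _))// (le_lt_trans (ler_norm _))// ltrDl.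
split=> [_ [x [r r0 ->]]|x A].
  rewrite openE => y xy; apply/nbhs_ballP; exists (r - mdist x y) => /=.
    by move: xy; rewrite ballEmdist subr_gt0.
  move=> z; move: xy; rewrite !ballEmdist/= => xy yz.
  by rewrite (le_lt_trans (metric_triangle x y z))// -ltrBrDl.
move=> /nbhs_ballP[r /= r0 rA]; exists (ball x r) => //.
by split; [exists x, r | exact: ballxx].
Qed.

Lemma cover_at_cover (U : set (set X)) (t : {posnum R}) :
  filtered_basis U -> forall x, exists2 A, cover_at U t%:num A & A x.
Proof.
move=> [[_ Ub] _] x.
have [A [UA Ax] At] := Ub x (ball x t%:num) (nbhsx_ballx _ _ (gt0 t)).
by exists A => //; split=> //; exists x.
Qed.

End FilteredBasis.

Arguments bounded_space {R} X.
Arguments cech_cover {R} X _.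

(* Main.v *)
(* If every member of a cover W lies in a member of a subcover U, then the
   inclusion N(U) -> N(W) is an isomorphism on homology: a vertex A of N(W)
   lying in B can be replaced by B in any chain, because adding B to a simplex through
   A gives again a simplex, and a cycle involves finitely many vertices.  Hence,
   whenever every member of U lies in a member of W, inclusions into N(U `|` W)
   give a map H(N(U)) -> H(N(W)), and these maps compose and agree with the maps
   induced by inclusions of covers.  The members of U_t lie in balls of C_t, and
   those of C_t in members of U_(t/delta), so the interleaving maps are of this
   kind, as are the structure maps, and the four identities follow. *)
From HB Require Import structures.
Require Import Defs.
From mathcomp Require Import all_boot all_order all_algebra all_fingroup.
From mathcomp Require Import finmap interval_inference boolp classical_sets.
From mathcomp Require Import cardinality fsbigop reals topology.

Set Implicit Arguments.
Unset Strict Implicit.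
Unset Printing Implicit Defensive.

Import Order.TTheory GRing.Theory Num.Theory.

Local Open Scope classical_set_scope.
Local Open Scope ring_scope.

(** * Finite sets of tuples and decomposition of permutations *)

Lemma finite_tuples_over (V : choiceType) n (s : seq V) :
  finite_set [set t : n.-tuple V | {subset t <= s}].
Proof.
apply: (@sub_finite_set _ _
  ((fun t : n.-tuple (seq_sub s) => map_tuple val t) @` setT)).
  move=> t /= ts; exists [tuple SeqSub (ts _ (mem_tnth i t)) | i < n] => //.
  by apply: eq_from_tnth => i; rewrite tnth_map tnth_mktuple.
exact/finite_image/finite_finset.
Qed.

(** Deleting row [i] and column [p i] from the permutation matrix of [p] leaves that of [q]. This is
    the form to which [odd_lift_perm] applies. *)
Lemma lift_perm_exists n (p : 'S_n.+1) (i : 'I_n.+1) :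
  exists q : 'S_n, p = lift_perm i (p i) q.
Proof.
(* The default [k] is never taken: by injectivity [p (lift i k)] differs from [p i]. *)
pose f (k : 'I_n) := odflt k (unlift (p i) (p (lift i k))).
have fE k : lift (p i) (f k) = p (lift i k).
  rewrite /f; case: unliftP => [j //|/perm_inj/esym/eqP].
  by rewrite (negbTE (neq_lift _ _)).
have f_inj : injective f.
  by move=> j k /(congr1 (lift (p i))); rewrite !fE => /perm_inj/lift_inj.
exists (perm f_inj); apply/permP => k; have [j ->|->] := unliftP i k.
  by rewrite lift_perm_lift permE fE.
by rewrite lift_perm_id.
Qed.

(** * Alternating functions on tuples *)

Section Wedge.
Variables (V : choiceType) (F : fieldType).
Implicit Types (a b v w x : V) (s : seq V).

Definition omit n (i : 'I_n.+1) (t : n.+1.-tuple V) : n.-tuple V :=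
  [tuple tnth t (lift i k) | k < n].

Lemma omit0 n x (t : n.-tuple V) : omit ord0 [tuple of x :: t] = t.
Proof. by apply: eq_from_tnth => i; rewrite tnth_mktuple tnthS. Qed.

Lemma omit_lift n (i : 'I_n.+1) x (t : n.+1.-tuple V) :
  omit (lift ord0 i) [tuple of x :: t] = [tuple of x :: omit i t].
Proof.
apply: eq_from_tnth => k; rewrite tnth_mktuple.
have [j ->|->] := unliftP ord0 k.
  rewrite [in RHS]tnthS tnth_mktuple -[RHS](tnthS x); congr tnth.
  by apply: val_inj; rewrite /= !/bump !add1n ltnS addnS.
by rewrite tnth0 (_ : lift _ _ = ord0) ?tnth0//; apply: val_inj.
Qed.

Lemma omit_permute n (i j : 'I_n.+1) (q : 'S_n) (t : n.+1.-tuple V) :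
  omit i (permute_tuple (lift_perm i j q) t) = permute_tuple q (omit j t).
Proof. by apply: eq_from_tnth => k; rewrite !tnth_mktuple lift_perm_lift. Qed.

Lemma mem_omit n (i : 'I_n.+1) (t : n.+1.-tuple V) :
  tval t =i tnth t i :: omit i t.
Proof.
move=> x; rewrite inE; apply/tnthP/predU1P => [[k ->]|[->|/tnthP[k ->]]].
- have [j ->|->] := unliftP i k; last by left.
  by right; apply/tnthP; exists j; rewrite tnth_mktuple.
- by exists i.
- by exists (lift i k); rewrite tnth_mktuple.
Qed.

(** Chains without a complex, allowed also on the empty tuple, where contracting a 0-chain lands. A
    finite list of vertices bounds the support; such a bound passes easily through [wedge] and
    [contract]. *)
Definition alternating n (c : n.-tuple V -> F^o) : Prop :=
  [/\ forall t, c t != 0 -> uniq t,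
      forall p t, c (permute_tuple p t) = (-1) ^+ p * c t
    & exists s, forall t, c t != 0 -> {subset t <= s} ].

(** Interior product: on v /\ c' + c'' with c' and c'' free of [v], its value is c'. *)
Definition contract v n (c : n.+1.-tuple V -> F^o) : n.-tuple V -> F^o :=
  fun t => c [tuple of v :: t].

(** Exterior product by [a] on the left, expanded along the position of [a] in the tuple. *)
Definition wedge a n (c : n.-tuple V -> F^o) : n.+1.-tuple V -> F^o :=
  fun t => \sum_(i < n.+1) (-1) ^+ i * ((tnth t i == a)%:R * c (omit i t)).

(** The formula of [boundary_fun], continued to the empty tuple, where it is the augmentation. *)
Definition bdry n (c : n.+1.-tuple V -> F^o) : n.-tuple V -> F^o :=
  fun t => \sum_(w \in [set: V]) c [tuple of w :: t].

Lemma bdryE n (c : n.+1.-tuple V -> F^o) s (t : n.-tuple V) :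
  uniq s -> (forall w, c [tuple of w :: t] != 0 -> w \in s) ->
  bdry c t = \sum_(w <- s) c [tuple of w :: t].
Proof.
move=> us cs; rewrite /bdry (fsbigE s)//.
- by apply: eq_bigl => w; rewrite in_setT.
- by move=> w _; apply: contraNeq; exact: cs.
Qed.

Lemma wedge_cons0 a (c : 0.-tuple V -> F^o) x (t : 0.-tuple V) :
  wedge a c [tuple of x :: t] = (x == a)%:R * c t.
Proof. by rewrite /wedge big_ord1 expr0 mul1r tnth0 omit0. Qed.

(** Contraction by [x] is an antiderivation: position 0 gives the first term, and shifting the other
    positions by one gives the minus sign. *)
Lemma wedge_cons a n (c : n.+1.-tuple V -> F^o) x (t : n.+1.-tuple V) :
  wedge a c [tuple of x :: t] =
  (x == a)%:R * c t - wedge a (contract x c) t.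
Proof.
rewrite /wedge big_ord_recl expr0 mul1r tnth0 omit0 -sumrN; congr (_ + _).
apply: eq_bigr => i _.
by rewrite tnthS omit_lift [in LHS]exprS mulN1r mulNr.
Qed.

Lemma wedgeN a n (c : n.-tuple V -> F^o) :
  wedge a (fun t => - c t) = fun t => - wedge a c t.
Proof.
apply/funext => t; rewrite /wedge -sumrN.
by apply: eq_bigr => i _; rewrite !mulrN.
Qed.

Lemma wedge0 a n :
  wedge a (fun=> 0 : F^o) = (fun=> 0) :> (n.+1.-tuple V -> F^o).
Proof. by apply/funext => t; apply: big1 => i _; rewrite !mulr0. Qed.

Lemma wedge_neq0 a n (c : n.-tuple V -> F^o) t :
  wedge a c t != 0 -> exists2 t' : n.-tuple V, c t' != 0 & tval t =i a :: t'.
Proof.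
move=> /eqP/eqP wt.
have [/existsP[i]|] :=
    boolP [exists i : 'I_n.+1, (tnth t i == a) && (c (omit i t) != 0)].
  move=> /andP[/eqP ti ci]; exists (omit i t) => // x.
  by rewrite (mem_omit i) ti.
move=> /existsPn h; move: wt; rewrite /wedge big1 ?eqxx// => i _.
have := h i; rewrite negb_and negbK => /orP[/negbTE ->|/eqP ->].
  by rewrite mul0r mulr0.
by rewrite !mulr0.
Qed.

(** Omitting position [i] after permuting by [p] is omitting [p i] and then permuting by some [q],
    and the signs of [p] and [q] differ by (-1)^(i + p i). Hence permuting the tuple reindexes the
    summands of [wedge], up to the sign of [p]. *)
Lemma wedge_term_permute a n (c : n.-tuple V -> F^o) (p : 'S_n.+1)
    (t : n.+1.-tuple V) (i : 'I_n.+1) :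
  (forall q u, c (permute_tuple q u) = (-1) ^+ q * c u) ->
  (-1) ^+ i * ((tnth (permute_tuple p t) i == a)%:R *
               c (omit i (permute_tuple p t))) =
  (-1) ^+ p * ((-1) ^+ p i * ((tnth t (p i) == a)%:R * c (omit (p i) t))).
Proof.
move=> cp; rewrite tnth_mktuple; have [q] := lift_perm_exists p i.
move: (p i) => j ->; rewrite omit_permute cp odd_lift_perm.
rewrite 2!signr_addb -[(-1) ^+ i]signr_odd -[(-1) ^+ j]signr_odd.
rewrite -!mulrA; congr (_ * _).
by rewrite [RHS]mulrCA signrMK mulrCA.
Qed.

Lemma alternating_wedge a n (c : n.-tuple V -> F^o) :
  alternating c -> alternating (wedge a c).
Proof.
move=> [c1 c2 [s cs]]; split=> [t|p t|]; last 2 first.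
- rewrite /wedge (eq_bigr _ (fun i _ => wedge_term_permute a p t i c2)).
  by rewrite -mulr_sumr [in RHS](reindex_inj (@perm_inj _ p)).
- exists (a :: s) => t /wedge_neq0[t' /cs t's tt'] x.
  by rewrite tt' !inE => /predU1P[->|/t's ->]; rewrite ?eqxx ?orbT.
(* In characteristic 2 antisymmetry does not force vanishing on repeated vertices, so the sum is
   cancelled by hand: the terms at [i] and [j] are opposite, and any other omission keeps the
   repetition. *)
apply: contraNT => /tuple_uniqP ninj.
have [i [j [tij ij]]] : exists i j, tnth t i = tnth t j /\ i != j.
  apply: contrapT => h; apply: ninj => i j tij; apply: contrapT => /eqP ij.
  by apply: h; exists i, j.
have tt : permute_tuple (tperm i j) t = t.
  apply: eq_from_tnth => k; rewrite tnth_mktuple.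
  by case: tpermP => [->|->|].
rewrite /wedge (bigD1 i)//= (bigD1 j) 1?eq_sym//= addrA big1 ?addr0 => [|k].
  rewrite -[in X in X + _]tt wedge_term_permute// tpermL odd_tperm ij expr1.
  by rewrite mulN1r addNr.
move=> /andP[ki kj]; suff -> : c (omit k t) = 0 by rewrite !mulr0.
have [i' iE _] := unlift_some ki; have [j' jE _] := unlift_some kj.
apply/eqP; apply: contraNT ij => /c1/tuple_uniqP o_inj; rewrite iE jE.
by apply/eqP; congr lift; apply: o_inj; rewrite !tnth_mktuple -iE -jE.
Qed.

Lemma alternating_contract v n (c : n.+1.-tuple V -> F^o) :
  alternating c -> alternating (contract v c).
Proof.
move=> [c1 c2 [s cs]]; split=> [t /c1/andP[]//|p t|].
  by rewrite /contract permute_tuple_cons c2 odd_lift_perm.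
by exists s => t /cs h x xt; apply: h; rewrite inE xt orbT.
Qed.

Lemma contract_contract u v n (c : n.+2.-tuple V -> F^o) : alternating c ->
  contract u (contract v c) = (fun t => - contract v (contract u c) t).
Proof.
move=> [_ c2 _]; apply/funext => t; rewrite /contract.
have := c2 (tperm ord0 (lift ord0 ord0)) [tuple of u :: [tuple of v :: t]].
rewrite odd_tperm expr1 mulN1r => <-.
congr (c _); apply: eq_from_tnth => i; rewrite tnth_mktuple.
case: tpermP => [->|->|/eqP + /eqP] //.
have [j ->|->//] := unliftP ord0 i.
have [k ->|->//] := unliftP ord0 j.
by rewrite !tnthS.
Qed.

Lemma contract2 v n (c : n.+2.-tuple V -> F^o) : alternating c ->
  contract v (contract v c) = fun=> 0.
Proof.
move=> [c1 _ _]; apply/funext => t; apply: contraTeq isT => /c1.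
by rewrite /= inE eqxx.
Qed.

(** A transposition brings [v] to the front at the cost of a sign. *)
Lemma alternating_eq0 v n (c : n.+1.-tuple V -> F^o) t :
  alternating c -> (forall u, contract v c u = 0) -> v \in tval t -> c t = 0.
Proof.
move=> [_ c2 _] c0 /tnthP[i vi].
have := tnth_mktuple (fun k => tnth t (tperm ord0 i k)) ord0.
have := c2 (tperm ord0 i) t; rewrite /permute_tuple tpermL -vi.
case/tupleP: (mktuple _) => x u + xv; rewrite tnth0 in xv.
rewrite xv [LHS](c0 u) => /esym/eqP.
by rewrite mulf_eq0 signr_eq0 => /eqP.
Qed.

(** [bdry] is the sum of all contractions, and contractions anticommute. *)
Lemma bdry_contract v n (c : n.+2.-tuple V -> F^o) : alternating c ->
  bdry (contract v c) = fun t => - contract v (bdry c) t.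
Proof.
move=> ac; have [_ _ [s cs]] := ac; apply/funext => t.
rewrite /contract !(@bdryE _ _ (undup s)) ?undup_uniq//.
- rewrite -sumrN; apply: eq_bigr => w _.
  exact: (congr1 (fun f => f t) (contract_contract w v ac)).
- by move=> w /cs h; rewrite mem_undup; apply: h; rewrite inE eqxx.
- by move=> w /cs h; rewrite mem_undup; apply: h; rewrite !inE eqxx orbT.
Qed.

Lemma bdry_wedge0 a (c : 0.-tuple V -> F^o) : bdry (wedge a c) = c.
Proof.
apply/funext => t; rewrite (@bdryE _ _ [:: a]) => // [|w].
  by rewrite big_seq1 wedge_cons0 eqxx mul1r.
rewrite wedge_cons0 inE; apply: contraNT => /negbTE ->.
by rewrite mul0r.
Qed.

(** Leibniz rule, obtained by summing [wedge_cons] over all first vertices. *)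
Lemma bdry_wedge a n (c : n.+1.-tuple V -> F^o) : alternating c ->
  bdry (wedge a c) = fun t => c t - wedge a (bdry c) t.
Proof.
move=> [_ _ [s cs]]; apply/funext => t; pose r := undup (a :: s).
have ur : uniq r by exact: undup_uniq.
have car (u : n.-tuple V) w : c [tuple of w :: u] != 0 -> w \in r.
  by move=> /cs h; rewrite mem_undup inE h ?orbT// inE eqxx.
rewrite (@bdryE _ _ r)// => [|w]; last first.
  move=> /wedge_neq0[u /cs us tu].
  have : w \in a :: u by rewrite -tu inE eqxx.
  by rewrite mem_undup !inE => /predU1P[->|/us ->]; rewrite ?eqxx ?orbT.
under eq_bigr do rewrite wedge_cons.
rewrite sumrB; congr (_ - _).
  rewrite (bigD1_seq a)//= ?mem_undup ?inE ?eqxx// mul1r big1 ?addr0// => w.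
  by move=> /negbTE ->; rewrite mul0r.
rewrite /wedge exchange_big; apply: eq_bigr => i _.
by rewrite -!mulr_sumr (bdryE ur)// => w; exact: car.
Qed.

Lemma alternatingD n (c d : n.-tuple V -> F^o) :
  alternating c -> alternating d -> alternating (fun t => c t + d t).
Proof.
move=> [c1 c2 [s cs]] [d1 d2 [r dr]].
have S t : c t + d t != 0 -> c t != 0 \/ d t != 0.
  by have [->|] := eqVneq (c t) 0; [rewrite add0r; right|left].
split=> [t /S[/c1|/d1]//|p t|]; first by rewrite c2 d2 mulrDr.
exists (s ++ r) => t /S[/cs|/dr] h x /h; rewrite mem_cat => -> //.
by rewrite orbT.
Qed.

Lemma alternatingN n (c : n.-tuple V -> F^o) :
  alternating c -> alternating (fun t => - c t).
Proof.
move=> [c1 c2 [s cs]]; split=> [t|p t|]; first by rewrite oppr_eq0 => /c1.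
  by rewrite c2 mulrN.
by exists s => t; rewrite oppr_eq0 => /cs.
Qed.

Lemma bdryD n (c d : n.+1.-tuple V -> F^o) : alternating c -> alternating d ->
  bdry (fun t => c t + d t) = fun t => bdry c t + bdry d t.
Proof.
move=> [_ _ [s cs]] [_ _ [r dr]]; apply/funext => t.
pose q := undup (s ++ r); have uq : uniq q by exact: undup_uniq.
have cq w : c [tuple of w :: t] != 0 -> w \in q.
  by move=> /cs h; rewrite mem_undup mem_cat h ?inE ?eqxx.
have dq w : d [tuple of w :: t] != 0 -> w \in q.
  by move=> /dr h; rewrite mem_undup mem_cat h ?orbT// inE eqxx.
rewrite !(@bdryE _ _ q)// ?big_split// => w.
have [->|] := eqVneq (c [tuple of w :: t]) 0.
  by rewrite add0r => /dq.
by move=> /cq.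
Qed.

Lemma bdryN n (c : n.+1.-tuple V -> F^o) : alternating c ->
  bdry (fun t => - c t) = fun t => - bdry c t.
Proof.
move=> ac; have [_ _ [s cs]] := ac; apply/funext => t.
rewrite !(@bdryE _ _ (undup s)) ?undup_uniq ?sumrN//.
  by move=> w /cs h; rewrite mem_undup h// inE eqxx.
by move=> w; rewrite oppr_eq0 => /cs h; rewrite mem_undup h// inE eqxx.
Qed.

(* The pushforward of c along the vertex map sending v to b and fixing every
   other vertex: contract v c is the coefficient of v in c, so only the part
   of c through v is altered, and it is altered by (b - v) /\ contract v c. *)
Definition replace v b n (c : n.+1.-tuple V -> F^o) : n.+1.-tuple V -> F^o :=
  fun t => c t + (wedge b (contract v c) t - wedge v (contract v c) t).

(** Each simplex through [v] is coned off at [b]; the boundary of the result is what [replace] adds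
    to a cycle. *)
Definition homotopy v b n (c : n.+1.-tuple V -> F^o) : n.+2.-tuple V -> F^o :=
  wedge v (wedge b (contract v c)).

Lemma alternating_replace v b n (c : n.+1.-tuple V -> F^o) :
  alternating c -> alternating (replace v b c).
Proof.
move=> ac; apply: alternatingD => //; apply: alternatingD.
  exact/alternating_wedge/alternating_contract.
exact/alternatingN/alternating_wedge/alternating_contract.
Qed.

Lemma alternating_homotopy v b n (c : n.+1.-tuple V -> F^o) :
  alternating c -> alternating (homotopy v b c).
Proof.
by move=> ac; do 2 apply: alternating_wedge; exact: alternating_contract.
Qed.

(** By the Leibniz rule the two wedge terms contribute [contract v c] with opposite signs, and
    [bdry_contract] rewrites what remains in terms of [bdry c]. *)
Lemma bdry_replace v b n (c : n.+2.-tuple V -> F^o) : alternating c ->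
  bdry (replace v b c) = replace v b (bdry c).
Proof.
move=> ac; have aw a := alternating_wedge a (alternating_contract v ac).
rewrite bdryD//; last by apply: alternatingD; [exact: aw|exact/alternatingN/aw].
rewrite bdryD//; last exact/alternatingN/aw.
rewrite bdryN//; have ai := alternating_contract v ac.
rewrite !bdry_wedge// bdry_contract// !wedgeN.
by apply/funext => t; rewrite /replace !opprK opprD addrACA subrr add0r.
Qed.

(** The second term of the antiderivation rule contracts twice by [v], hence vanishes. *)
Lemma contract_wedge v b n (c : n.+1.-tuple V -> F^o) : alternating c ->
  contract v (wedge b (contract v c)) =
  fun t => (v == b)%:R * contract v c t.
Proof.
move=> ac; apply/funext => t; case: n c ac t => [|n] c ac t.
  by rewrite [LHS]wedge_cons0.
by rewrite [LHS]wedge_cons contract2// wedge0 subr0.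
Qed.

(** Under contraction by [v], the term in [wedge v] cancels [c] and the term in [wedge b] gives
    0. *)
Lemma replace_eq0 v b n (c : n.+1.-tuple V -> F^o) t : alternating c ->
  b != v -> v \in tval t -> replace v b c t = 0.
Proof.
move=> ac bv; apply: alternating_eq0; first exact: alternating_replace.
move=> u; rewrite [LHS](_ : _ = contract v c u +
  (contract v (wedge b (contract v c)) u -
   contract v (wedge v (contract v c)) u))//.
rewrite !contract_wedge// eqxx [v == b]eq_sym (negbTE bv).
by rewrite mul0r mul1r sub0r subrr.
Qed.

Lemma replace_neq0 v b n (c : n.+1.-tuple V -> F^o) t : alternating c ->
  b != v -> replace v b c t != 0 ->
  v \notin tval t /\
  (c t != 0 \/ exists2 u : n.-tuple V, contract v c u != 0 & tval t =i b :: u).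
Proof.
move=> ac bv rt; have vt : v \notin tval t.
  by apply: contraNN rt => /(replace_eq0 ac bv) ->.
split=> //; have [ct|] := eqVneq (c t) 0; last by left.
right; apply: wedge_neq0; move: rt; rewrite /replace ct add0r.
have [->|/wedge_neq0[u _ tu]] := eqVneq (wedge v (contract v c) t) 0.
  by rewrite subr0.
by rewrite tu inE eqxx in vt.
Qed.

Lemma homotopy_neq0 v b n (c : n.+1.-tuple V -> F^o) t :
  homotopy v b c t != 0 ->
  exists2 u : n.-tuple V, contract v c u != 0 & tval t =i [:: v, b & u].
Proof.
move=> /wedge_neq0[u' /wedge_neq0[u cu u'u] tu']; exists u => // x.
by rewrite tu' inE u'u !inE.
Qed.

(** Finitely many tuples have finitely many vertices; conversely, a finite list of vertices yields
    finitely many tuples of a given length. *)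
Lemma is_chainE (K : simplicial_complex V) n (c : n.+1.-tuple V -> F^o) :
  is_chain K c <->
  alternating c /\ forall t, c t != 0 -> face K [fset x in tval t]%fset.
Proof.
split=> [[c1 c2 c3]|[[c1 c2 [s cs]] cK]]; split.
- split=> // [t /c1[]//|].
  exists (flatten [seq tval t | t <- fset_set [set t | c t != 0]]) => t ct x xt.
  apply/flatten_mapP; exists t => //.
  by rewrite in_fset_set// inE.
- by move=> t /c1[].
- by move=> t ct; split; [exact: c1|exact: cK].
- by [].
- by apply: sub_finite_set (finite_tuples_over _ s) => t /cs.
Qed.

End Wedge.

(** * Homology of a dominating full subcomplex *)

Section Domination.
Variables (V : choiceType) (F : fieldType).
Implicit Types (K L : simplicial_complex V) (v b x : V).

Lemma chain_alternating K n (c : chain F K n) : alternating c.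
Proof. by have [] := (is_chainE _ _).1 (chainP c). Qed.

Lemma chain_face K n (c : chain F K n) (t : n.+1.-tuple V) :
  c t != 0 -> face K [fset x in tval t]%fset.
Proof. by have [_ +] := (is_chainE _ _).1 (chainP c); exact. Qed.

Lemma chain_vertex K n (c : chain F K n) (t : n.+1.-tuple V) x :
  c t != 0 -> x \in tval t -> face K [fset x]%fset.
Proof.
move=> /chain_face ft xt; apply: face_sub ft _ _; first by rewrite fsub1set inE.
by apply/fset0Pn; exists x; rewrite inE.
Qed.

(** For a vertex [v] and [b != v]: the link of [v] is a cone with apex [b]. *)
Definition dominated K v b : Prop :=
  forall s : {fset V}, face K s -> v \in s -> face K (b |` s)%fset.

Lemma dominated_face K n (c : chain F K n) v b (t : n.-tuple V) (r : seq V) :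
  dominated K v b -> contract v c t != 0 -> r != [::] ->
  {subset r <= [:: b, v & t]} -> face K [fset x in r]%fset.
Proof.
move=> Kvb /chain_face/Kvb; rewrite inE /= inE eqxx => /(_ isT) Kt.
case: r => // x r _ rt; apply: face_sub Kt _ _.
  by apply/fsubsetP => y; move: (rt y); rewrite !inE.
by apply/fset0Pn; exists x; rewrite !inE eqxx.
Qed.

Lemma replace_is_chain K n (c : chain F K n) v b :
  b != v -> dominated K v b -> is_chain K (replace v b c).
Proof.
move=> bv Kvb; have ac := chain_alternating c; apply/is_chainE.
split=> [|t]; first exact: alternating_replace.
move=> /(replace_neq0 ac bv)[vt [/chain_face//|[u cu tu]]].
apply: (dominated_face Kvb cu) => [|x]; first by case: t {vt tu} => -[].
by rewrite tu !inE => /predU1P[->|->]; rewrite ?eqxx ?orbT.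
Qed.

Lemma homotopy_is_chain K n (c : chain F K n) v b :
  dominated K v b -> is_chain K (homotopy v b c).
Proof.
move=> Kvb; have ac := chain_alternating c; apply/is_chainE.
split=> [|t]; first exact: alternating_homotopy.
move=> /homotopy_neq0[u cu tu].
apply: (dominated_face Kvb cu) => [|x]; first by case: t {tu} => -[].
by rewrite tu !inE orbCA.
Qed.

Lemma boundary_is_cycle K n (d : chain F K n.+1) :
  boundary d \in @cycle_pred V F K n.
Proof. by case: n d => // n d; apply/eqP; exact: boundary_boundary. Qed.

(* b /\ contract v z has boundary contract v z - b /\ bdry (contract v z), and
   the last term vanishes because z is a cycle. *)
Lemma replace_cycle K n (z : Defs.cycle F K n) v b :
  replace v b z = fun t => z t + bdry (homotopy v b z) t.
Proof.
have az := chain_alternating z; have ai := alternating_contract v az.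
suff h : bdry (wedge b (contract v z)) = contract v z.
  by rewrite /homotopy bdry_wedge ?h//; exact: alternating_wedge.
(* In degree 0 the contraction lives on the empty tuple and has no boundary term. *)
case: n z az ai => [|n] z az ai; first exact: bdry_wedge0.
have z0 : bdry z = fun=> 0.
  by have /eqP/(congr1 val) := cycle_chainP z.
rewrite bdry_wedge// bdry_contract// z0.
by apply/funext => t; rewrite /contract oppr0 wedge0 subr0.
Qed.

Lemma homology_classP K n (z z' : Defs.cycle F K n) :
  homology_class z = homology_class z' <->
  exists d : chain F K n.+1, boundary d = z - z' :> chain F K n.
Proof.
by split=> [/quotient_projP/asboolP//|h]; apply/quotient_projP/asboolP.
Qed.

(** Vertices outside [P] are eliminated one at a time. Domination is taken in [L], where the
    intermediate chains still live. *)
Variables (K L : simplicial_complex V) (KL : subcomplex K L) (P : set V).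
Hypothesis K_full : forall s : {fset V},
  face K s <-> face L s /\ forall x, x \in s -> P x.
Hypothesis L_dominated : forall v, face L [fset v]%fset ->
  exists2 b, P b & dominated L v b.

Lemma is_chain_full n (c : chain F L n) :
  (forall t : n.+1.-tuple V, c t != 0 -> forall x, x \in tval t -> P x) ->
  is_chain K c.
Proof.
move=> cP; apply/is_chainE; split=> [|t ct]; first exact: chain_alternating.
apply/K_full; split=> [|x]; first exact: chain_face ct.
by rewrite inE => xt; exact: cP xt.
Qed.

(** Replacing [v] introduces only [b], which is in [P], so the list of vertices still to be
    eliminated gets shorter. *)
Lemma replace_supported n (c : chain F L n) v b (s : seq V) :
  b != v -> P b ->
  (forall t : n.+1.-tuple V, c t != 0 ->
    forall x, x \in tval t -> P x \/ x \in v :: s) ->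
  forall t : n.+1.-tuple V, replace v b c t != 0 ->
    forall x, x \in tval t -> P x \/ x \in s.
Proof.
move=> bv Pb cs t /(replace_neq0 (chain_alternating c) bv)[vt ct] x xt.
have xv : x != v by apply: contraNneq vt => <-.
suff : P x \/ x \in v :: s by rewrite inE (negbTE xv).
case: ct => [/cs|[u /cs cu tu]]; first exact.
move: xt; rewrite tu inE => /predU1P[->|xu]; first by left.
by apply: cu; rewrite inE xu orbT.
Qed.

(** Successive replacements push the filling [c] into [K] while its boundary [z] stays fixed. *)
Lemma homology_incl_inj_chain n (s : seq V) (c : chain F L n.+1)
    (z : chain F K n) :
  boundary c = chain_incl KL z ->
  (forall t : n.+2.-tuple V, c t != 0 ->
    forall x, x \in tval t -> P x \/ x \in s) ->
  exists d : chain F K n.+1, boundary d = z.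
Proof.
elim: s c => [|v s IH] c cz cs.
  have cK : is_chain K c.
    by apply: is_chain_full => t ct x /(cs _ ct)[].
  exists (Chain (asboolT cK)); apply: val_inj.
  by have := congr1 val cz.
have [Pv|/not_implyP[Lv nPv]] := pselect (face L [fset v]%fset -> P v).
  apply: (IH c) => // t ct x xt; have [|] := cs t ct x xt; first by left.
  rewrite inE => /predU1P[xv|]; last by right.
  by rewrite xv in xt *; left; exact: Pv (chain_vertex ct xt).
have [b Pb Lvb] := L_dominated Lv.
have bv : b != v by apply: contra_notN nPv => /eqP <-.
apply: (IH (Chain (asboolT (replace_is_chain c bv Lvb)))) => /=; last first.
  exact: replace_supported.
apply: val_inj; rewrite -cz.
apply: (etrans (bdry_replace v b (chain_alternating c))).
have -> : bdry c = z by have := congr1 val cz.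
(* As [v] is outside [P], it does not occur in [z], so the replacement fixes [z]. *)
have z0 : contract v z = fun=> 0.
  apply/funext => t; apply: contra_notP nPv => /eqP/chain_face/K_full[_].
  by apply; rewrite !inE eqxx.
by apply/funext => t; rewrite /replace z0 !wedge0 subr0 addr0 (congr1 val cz).
Qed.

(** By [replace_cycle], each replacement changes the cycle by a boundary only, so its class survives
    until the cycle lies in [K]. *)
Lemma homology_incl_surj_cycle n (s : seq V) (z : Defs.cycle F L n) :
  (forall t : n.+1.-tuple V, z t != 0 ->
    forall x, x \in tval t -> P x \/ x \in s) ->
  exists y : Defs.cycle F K n,
    homology_incl KL (homology_class y) = homology_class z.
Proof.
elim: s z => [|v s IH] z zs.
  have zK : is_chain K z.
    by apply: is_chain_full => t zt x /(zs _ zt)[].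
  have yP : Chain (asboolT zK) \in @cycle_pred V F K n.
    case: n z zs zK => // n z zs zK; apply/eqP; apply: val_inj.
    by have /eqP/(congr1 val) := cycle_chainP z.
  exists (Cycle yP); rewrite homology_inclE; congr homology_class.
  by do 2 apply: val_inj.
have [Pv|/not_implyP[Lv nPv]] := pselect (face L [fset v]%fset -> P v).
  apply: IH => t zt x xt; have [|] := zs t zt x xt; first by left.
  rewrite inE => /predU1P[xv|]; last by right.
  by rewrite xv in xt *; left; exact: Pv (chain_vertex zt xt).
have [b Pb Lvb] := L_dominated Lv.
have bv : b != v by apply: contra_notN nPv => /eqP <-.
pose d : chain F L n.+1 := Chain (asboolT (homotopy_is_chain z Lvb)).
(* Written as [z] plus a boundary, the replacement is visibly a cycle homologous to [z]. *)
have z'P : cycle_chain z + boundary d \in @cycle_pred V F L n.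
  by rewrite rpredD ?boundary_is_cycle ?cycle_chainP.
have z'E : Cycle z'P = replace v b z :> (n.+1.-tuple V -> F^o).
  by rewrite replace_cycle.
have [|y yz'] := IH (Cycle z'P).
  by move=> t; rewrite z'E; exact: replace_supported.
exists y; rewrite yz'; apply/homology_classP; exists d.
by rewrite /= addrC addKr.
Qed.

Lemma chain_vertices n (c : chain F L n) : exists s : seq V,
  forall t : n.+1.-tuple V, c t != 0 ->
    forall x, x \in tval t -> P x \/ x \in s.
Proof.
have [_ _ [s cs]] := chain_alternating c.
by exists s => t /cs h x /h; right.
Qed.

Lemma homology_incl_inj n : injective (@homology_incl V F K L KL n).
Proof.
move=> u w; have [y ->] := homology_classK u; have [z ->] := homology_classK w.
rewrite !homology_inclE => /homology_classP[d dyz].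
have [s ds] := chain_vertices d.
apply/homology_classP; apply: (homology_incl_inj_chain (c := d) (s := s)) => //.
by rewrite dyz linearB.
Qed.

Lemma homology_incl_surj n (w : homology F L n) :
  exists u, @homology_incl V F K L KL n u = w.
Proof.
have [z ->] := homology_classK w; have [s zs] := chain_vertices z.
have [y yz] := homology_incl_surj_cycle zs.
by exists (homology_class y).
Qed.

End Domination.

Lemma homology_incl_comp (V : choiceType) (F : fieldType)
    (K L M : simplicial_complex V) (KL : subcomplex K L) (LM : subcomplex L M)
    (KM : subcomplex K M) n (u : homology F K n) :
  homology_incl LM (homology_incl KL u) = homology_incl KM u.
Proof.
have [z ->] := homology_classK u; rewrite !homology_inclE.
by congr homology_class; do 2 apply: val_inj.
Qed.

(** * Nerves of covers *)

Section NerveTransfer.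
Variables (X : Type) (F : fieldType) (n : nat).
Implicit Types U W Z : set (set X).

Definition refines U W : Prop := forall A, U A -> exists2 B, W B & A `<=` B.

Lemma sub_refines U W : U `<=` W -> refines U W.
Proof. by move=> UW A /UW WA; exists A. Qed.

Lemma refines_trans U W Z : refines U W -> refines W Z -> refines U Z.
Proof.
move=> UW WZ A /UW[B /WZ[C ZC BC] AB]; exists C => //.
exact: subset_trans BC.
Qed.

Lemma setU_refines U W Z : refines U Z -> refines W Z -> refines (U `|` W) Z.
Proof. by move=> UZ WZ A [/UZ|/WZ]. Qed.

Lemma nerve_full U W : U `<=` W -> forall s : {fset set X},
  face (nerve U) s <-> face (nerve W) s /\ forall A, A \in s -> U A.
Proof.
move=> UW s; split=> [[s0 sU sx]|[[s0 _ sx] sU]]; split=> //.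
by split=> // A /sU/UW.
Qed.

(** A point common to a family through [A] also lies in any [B] containing [A], so [B] can join the
    family. *)
Lemma nerve_dominated U W : refines W U -> U `<=` W -> forall A,
  face (nerve W) [fset A]%fset -> exists2 B, U B & dominated (nerve W) A B.
Proof.
move=> WU UW A [_ /(_ A)]; rewrite inE eqxx => /(_ isT)/WU[B UB AB] _.
exists B => // s [s0 sW [x sx]] As; split.
- by apply/fset0Pn; exists B; rewrite !inE eqxx.
- by move=> C; rewrite !inE => /predU1P[->|/sW//]; exact: UW.
- by exists x => C; rewrite !inE => /predU1P[->|/sx//]; apply: AB; exact: sx As.
Qed.

Lemma nerve_incl_inj U W (UW : U `<=` W) : refines W U ->
  injective (@homology_incl _ F _ _ (nerve_sub UW) n).
Proof.
move=> WU.
exact: (homology_incl_inj (nerve_full UW) (nerve_dominated WU UW)).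
Qed.

Lemma nerve_incl_surj U W (UW : U `<=` W) : refines W U ->
  forall w, exists u, @homology_incl _ F _ _ (nerve_sub UW) n u = w.
Proof.
move=> WU.
exact: (homology_incl_surj _ (nerve_full UW) (nerve_dominated WU UW)).
Qed.

Lemma nerve_transfer_exists U W (UW : refines U W)
    (u : homology F (nerve U) n) :
  exists w, homology_incl (nerve_sub (@subsetUr _ U W)) w =
            homology_incl (nerve_sub (@subsetUl _ U W)) u.
Proof. by apply/nerve_incl_surj/setU_refines => //; exact: sub_refines. Qed.

(* The composite H(N(U)) -> H(N(U `|` W)) <~ H(N(W)).  It is the map induced by
   any choice A |-> B with A `<=` B, but requires no such choice. *)
Definition nerve_transfer U W (UW : refines U W) (u : homology F (nerve U) n) :
  homology F (nerve W) n := sval (cid (nerve_transfer_exists UW u)).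

(** In any common larger cover the transfer becomes an inclusion; where [WZ] is injective on
    homology, this determines it. *)
Lemma nerve_transferE U W Z (UW : refines U W) (UZ : U `<=` Z) (WZ : W `<=` Z)
    u :
  homology_incl (nerve_sub WZ) (nerve_transfer UW u) =
  homology_incl (nerve_sub UZ) u.
Proof.
have UWZ : U `|` W `<=` Z by rewrite subUset.
rewrite -(homology_incl_comp (nerve_sub (@subsetUr _ U W)) (nerve_sub UWZ)).
rewrite /nerve_transfer; case: cid => /= w ->.
exact: homology_incl_comp.
Qed.

Fact nerve_transfer_is_linear U W (UW : refines U W) :
  linear (nerve_transfer UW).
Proof.
move=> a u w; have WUW : refines (U `|` W) W.
  by apply: setU_refines => //; exact: sub_refines.
apply: (nerve_incl_inj (UW := @subsetUr _ U W) WUW).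
by rewrite nerve_transferE !linearP /= !nerve_transferE.
Qed.
HB.instance Definition _ U W (UW : refines U W) :=
  GRing.isLinear.Build F (homology F (nerve U) n) (homology F (nerve W) n) *:%R
    (nerve_transfer UW) (nerve_transfer_is_linear UW).

(** All three covers refine [Z], so the two sides may be compared in the nerve of their union, into
    which the homology of [nerve Z] injects. *)
Lemma nerve_transfer_comp U W Z (UW : refines U W) (WZ : refines W Z)
    (UZ : refines U Z) u :
  nerve_transfer WZ (nerve_transfer UW u) = nerve_transfer UZ u.
Proof.
have UT : U `<=` U `|` W `|` Z by move=> A ?; left; left.
have WT : W `<=` U `|` W `|` Z by move=> A ?; left; right.
have ZT : Z `<=` U `|` W `|` Z by move=> A ?; right.
apply: (nerve_incl_inj (UW := ZT)).
  by do 2?[apply: setU_refines => //]; exact: sub_refines.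
by rewrite (nerve_transferE _ WT) (nerve_transferE _ UT) (nerve_transferE _ UT).
Qed.

(** Here [W] itself serves as the common larger cover. Structure maps thereby become transfers. *)
Lemma nerve_transfer_incl U W (UW : refines U W) (sUW : U `<=` W)
    (KL : subcomplex (nerve U) (nerve W)) u :
  nerve_transfer UW u = homology_incl KL u.
Proof.
have WW : W `<=` W by [].
apply: (nerve_incl_inj (UW := WW)); first exact: sub_refines.
by rewrite (nerve_transferE _ sUW) (homology_incl_comp _ _ (nerve_sub sUW)).
Qed.

End NerveTransfer.

(** * Interleaving with the Čech filtration *)

Section CechInterleaving.
Variables (R : realType) (X : metricType R).
Implicit Types U : set (set X).

Lemma refines_cech U (s t : R) : 0 < s -> s <= t ->
  refines (cover_at U s) (cover_at (cech_cover X) t).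
Proof.
move=> s0 st A [_ [x Ax]]; exists (ball x s) => //; split.
  by exists x, s.
by exists x; exact: le_ball.
Qed.

(** The basis condition at radius [t] provides a member of [cover_at U t] around the ball of radius
    [delta * t], hence around [A]. *)
Lemma cech_refines (delta : R) U (s t : R) : 0 < t -> s <= delta * t ->
  delta_filtered_basis delta U ->
  refines (cover_at (cech_cover X) s) (cover_at U t).
Proof.
move=> t0 st [_ Ud] A [_ [x Ax]]; have [B UB xB] := Ud x t t0.
by exists B => //; apply: subset_trans Ax (subset_trans (le_ball st) xB).
Qed.

End CechInterleaving.

Theorem theorem2p10 (R : realType) (F : fieldType) (X : metricType R)
    (delta : {posnum R}) (U : set (set X)) :
  bounded_space X ->
  delta%:num <= 1 ->
  delta_filtered_basis delta%:num U ->
  forall n : nat,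
    multiplicatively_interleaved 1%:pos (1 / delta%:num)%:pos
      (persistent_homology F (filtered_nerve U) n)
      (persistent_homology F (filtered_nerve (cech_cover X)) n).
Proof.
move=> _ delta1 Ud n.
have UC (t : {posnum R}) : refines (cover_at U t%:num)
    (cover_at (cech_cover X) (mul_pos 1%:pos t)%:num).
  by apply: refines_cech => //; rewrite /= mul1r.
have CU (t : {posnum R}) : refines (cover_at (cech_cover X) t%:num)
    (cover_at U (mul_pos (1 / delta%:num)%:pos t)%:num).
  (* The factor 1/delta is chosen so that [delta] times the new radius is [t] again. *)
  by apply: (cech_refines (delta := delta%:num)) => //; rewrite /= div1r mulVKf.
(* With the structure maps also written as transfers, each identity equates composites of transfers
   with the same source and target. *)
have mapE (W : set (set X)) (s t : {posnum R}) (st : s%:num <= t%:num) u :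
    pm_map (persistent_homology F (filtered_nerve W) n) st u =
    nerve_transfer (sub_refines (@cover_at_le _ _ W _ _ st)) u.
  exact/esym/nerve_transfer_incl/cover_at_le.
split; [by []|by rewrite /= div1r invf_ge1|].
exists (fun t => nerve_transfer (UC t) : {linear _ -> _}),
  (fun t => nerve_transfer (CU t) : {linear _ -> _}).
split=> [t le w|t le v|s t st le w|s t st le v]; rewrite !mapE.
- exact: nerve_transfer_comp.
- exact: nerve_transfer_comp.
(* The right side is merged into one transfer along an explicitly given refinement; the left side
   then composes to the same transfer. *)
- rewrite /= [RHS](nerve_transfer_comp _ _ (refines_trans (CU s)
    (sub_refines (cover_at_le le)))).
  exact: nerve_transfer_comp.
- rewrite /= [RHS](nerve_transfer_comp _ _ (refines_trans (UC s)
    (sub_refines (cover_at_le le)))).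
  exact: nerve_transfer_comp.
Qed.
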